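(* Let $\Omega$ be a semigroup with unit $1$, $(L,\mu,p)$ a Hom-associative algebra, $(V,\mu_l,\mu_r,q)$ a bimodule over it, $\Phi$ a 2-cocycle of $L$ with coefficients in $V$, and $\{R_\alpha:V\to L\}_{\alpha\in\Omega}$ a $\Phi$-twisted Rota-Baxter family operator. For $\alpha,\beta\in\Omega$ define bilinear maps $$\lhd_{\alpha,\beta}:V\otimes L\to L,\qquad u\lhd_{\alpha,\beta}x=R_\alpha u\cdot x-R_{\alpha\beta}(u\cdot_r x)-R_{\alpha\beta}\Phi(R_\alpha u,x),$$ $$\rhd_{\alpha,\beta}:L\otimes V\to L,\qquad x\rhd_{\alpha,\beta}u=x\cdot R_\beta u-R_{\alpha\beta}(x\cdot_l u)-R_{\alpha\beta}\Phi(x,R_\beta u).$$ Then $(L,\{\lhd_{\alpha,\beta},\rhd_{\alpha,\beta}\}_{\alpha,\beta\in\Omega},p)$ (with $\lhd_{\alpha,\beta}$ as left actions and $\rhd_{\alpha,\beta}$ as right actions) is a bimodule over the Hom-$\Omega$-associative algebra $(V,\{*_{\alpha,\beta}\}_{\alpha,\beta\in\Omega},q)$ given by $$u*_{\alpha,\beta}v=R_\alpha u\cdot_l v+u\cdot_r R_\beta v+\Phi(R_\alpha u,R_\beta v).$$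
   Context: Work over a field $\mathbb{K}$ of characteristic $0$. A Hom-associative algebra $(L,\mu,p)$ is a vector space $L$ with a linear map $p:L\to L$ and a bilinear product $\mu(x,y)=x\cdot y$ such that $p(x\cdot y)=p(x)\cdot p(y)$ and $p(x)\cdot(y\cdot z)=(x\cdot y)\cdot p(z)$. A bimodule $(V,\mu_l,\mu_r,q)$ over it is a vector space $V$ with a linear map $q:V\to V$ and bilinear maps $\mu_l:L\times V\to V$, $(x,u)\mapsto x\cdot_l u$, and $\mu_r:V\times L\to V$, $(u,x)\mapsto u\cdot_r x$, such that $q(x\cdot_l u)=p(x)\cdot_l q(u)$, $q(u\cdot_r x)=q(u)\cdot_r p(x)$, $q(u)\cdot_r(x\cdot y)=(u\cdot_r x)\cdot_r p(y)$, $p(x)\cdot_l(u\cdot_r y)=(x\cdot_l u)\cdot_r p(y)$, $p(x)\cdot_l(y\cdot_l u)=(x\cdot y)\cdot_l q(u)$. A 2-cocycle of $L$ with coefficients in $V$ is a bilinear map $\Phi:L\otimes L\to V$ with $q\,\Phi(x_1,x_2)=\Phi(p(x_1),p(x_2))$ and $p(x_1)\cdot_l\Phi(x_2,x_3)-\Phi(x_1,x_2)\cdot_r p(x_3)-\Phi(x_1\cdot x_2,p(x_3))+\Phi(p(x_1),x_2\cdot x_3)=0$. A $\Phi$-twisted Rota-Baxter family operator is a collection of linear maps $\{R_\alpha:V\to L\}_{\alpha\in\Omega}$ with $R_\alpha\circ q=p\circ R_\alpha$ and $R_\alpha u\cdot R_\beta v=R_{\alpha\beta}(R_\alpha u\cdot_l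 v+u\cdot_r R_\beta v+\Phi(R_\alpha u,R_\beta v))$ for all $u,v\in V$, $\alpha,\beta\in\Omega$. A Hom-$\Omega$-associative algebra $(G,\{\cdot_{\alpha,\beta}\}_{\alpha,\beta\in\Omega},P)$ is a vector space $G$ with bilinear operations $\cdot_{\alpha,\beta}:G\otimes G\to G$ and a linear map $P:G\to G$ such that $P(x\cdot_{\alpha,\beta}y)=P(x)\cdot_{\alpha,\beta}P(y)$ and $P(x)\cdot_{\alpha,\beta\gamma}(y\cdot_{\beta,\gamma}z)=(x\cdot_{\alpha,\beta}y)\cdot_{\alpha\beta,\gamma}P(z)$ for all $x,y,z\in G$, $\alpha,\beta,\gamma\in\Omega$. (The triple $(V,\{*_{\alpha,\beta}\},q)$ above is such an algebra.) A bimodule over a Hom-$\Omega$-associative algebra $(G,\{\cdot_{\alpha,\beta}\},P)$ is a vector space $W$ with a linear map $Q:W\to W$ and bilinear left actions $G\otimes W\to W$, $(x,w)\mapsto x\cdot_{l_{\alpha,\beta}}w$, and right actions $W\otimes G\to W$, $(w,x)\mapsto w\cdot_{r_{\alpha,\beta}}x$ ($\alpha,\beta\in\Omega$) such that for all $x,y\in G$, $w\in W$, $\alpha,\beta,\gamma\in\Omega$: $Q(x\cdot_{l_{\alpha,\beta}}w)=P(x)\cdot_{l_{\alpha,\beta}}Q(w)$, $Q(w\cdot_{r_{\alpha,\beta}}x)=Q(w)\cdot_{r_{\alpha,\beta}}P(x)$; $Q(w)\cdot_{r_{\alpha,\beta\gamma}}(x\cdot_{\beta,\gamma}y)=(w\cdot_{r_{\alpha,\beta}}x)\cdot_{r_{\alpha\beta,\gamma}}P(y)$;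 $P(x)\cdot_{l_{\alpha,\beta\gamma}}(w\cdot_{r_{\beta,\gamma}}y)=(x\cdot_{l_{\alpha,\beta}}w)\cdot_{r_{\alpha\beta,\gamma}}P(y)$; $P(x)\cdot_{l_{\alpha,\beta\gamma}}(y\cdot_{l_{\beta,\gamma}}w)=(x\cdot_{\alpha,\beta}y)\cdot_{l_{\alpha\beta,\gamma}}Q(w)$. *)

(* Defs.v *)
From HB Require Import structures.
From mathcomp Require Import all_boot all_order all_algebra.
Set Implicit Arguments.
Unset Strict Implicit.
Unset Printing Implicit Defensive.
Import GRing.Theory.
Local Open Scope ring_scope.

Section HomAssociative.
Variables (K : fieldType) (L V : lmodType K).
Variables (mu : {bilinear L -> L -> L}) (p : {linear L -> L}).
Variables (mu_l : {bilinear L -> V -> V}) (mu_r : {bilinear V -> L -> V})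
          (q : {linear V -> V}).

Record hom_assoc : Prop := HomAssoc {
  hom_assocM : forall x y, p (mu x y) = mu (p x) (p y);
  hom_assocA : forall x y z, mu (p x) (mu y z) = mu (mu x y) (p z)
}.

Record hom_bimodule : Prop := HomBimodule {
  hom_bimodMl : forall x u, q (mu_l x u) = mu_l (p x) (q u);
  hom_bimodMr : forall u x, q (mu_r u x) = mu_r (q u) (p x);
  hom_bimodArr : forall u x y, mu_r (q u) (mu x y) = mu_r (mu_r u x) (p y);
  hom_bimodAlr : forall x u y, mu_l (p x) (mu_r u y) = mu_r (mu_l x u) (p y);
  hom_bimodAll : forall x y u, mu_l (p x) (mu_l y u) = mu_l (mu x y) (q u)
}.

Record hom_cocycle2 (Phi : {bilinear L -> L -> V}) : Prop := HomCocycle2 {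
  hom_cocycle2M : forall x1 x2, q (Phi x1 x2) = Phi (p x1) (p x2);
  hom_cocycle2D : forall x1 x2 x3,
    mu_l (p x1) (Phi x2 x3) - mu_r (Phi x1 x2) (p x3)
      - Phi (mu x1 x2) (p x3) + Phi (p x1) (mu x2 x3) = 0
}.

End HomAssociative.

Section HomOmegaAssociative.
Variables (Omega : monoidType) (K : fieldType) (G W : lmodType K).
Variables (op : Omega -> Omega -> {bilinear G -> G -> G})
          (P : {linear G -> G}).
Variables (opl : Omega -> Omega -> {bilinear G -> W -> W})
          (opr : Omega -> Omega -> {bilinear W -> G -> W})
          (Q : {linear W -> W}).

Record hom_omega_assoc : Prop := HomOmegaAssoc {
  hom_omega_assocM : forall x y a b, P (op a b x y) = op a b (P x) (P y);
  hom_omega_assocA : forall x y z a b c,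
    op a (b * c)%g (P x) (op b c y z) = op (a * b)%g c (op a b x y) (P z)
}.

Record hom_omega_bimodule : Prop := HomOmegaBimodule {
  hom_omega_bimodMl : forall x w a b,
    Q (opl a b x w) = opl a b (P x) (Q w);
  hom_omega_bimodMr : forall w x a b,
    Q (opr a b w x) = opr a b (Q w) (P x);
  hom_omega_bimodArr : forall w x y a b c,
    opr a (b * c)%g (Q w) (op b c x y) = opr (a * b)%g c (opr a b w x) (P y);
  hom_omega_bimodAlr : forall x w y a b c,
    opl a (b * c)%g (P x) (opr b c w y) = opr (a * b)%g c (opl a b x w) (P y);
  hom_omega_bimodAll : forall x y w a b c,
    opl a (b * c)%g (P x) (opl b c y w) = opl (a * b)%g c (op a b x y) (Q w)
}.

End HomOmegaAssociative.

Section TwistedRotaBaxterFamily.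
Variables (Omega : monoidType) (K : fieldType) (L V : lmodType K).
Variables (mu : {bilinear L -> L -> L}) (p : {linear L -> L}).
Variables (mu_l : {bilinear L -> V -> V}) (mu_r : {bilinear V -> L -> V})
          (q : {linear V -> V}).
Variables (Phi : {bilinear L -> L -> V}) (R : Omega -> {linear V -> L}).

Record twisted_RB_family : Prop := TwistedRBFamily {
  twisted_RB_familyC : forall a u, R a (q u) = p (R a u);
  twisted_RB_familyM : forall u v a b,
    mu (R a u) (R b v) =
      R (a * b)%g (mu_l (R a u) v + mu_r u (R b v) + Phi (R a u) (R b v))
}.

Definition RB_star (a b : Omega) (u v : V) : V :=
  mu_l (R a u) v + mu_r u (R b v) + Phi (R a u) (R b v).

Definition RB_lhd (a b : Omega) (u : V) (x : L) : L :=
  mu (R a u) x - R (a * b)%g (mu_r u x) - R (a * b)%g (Phi (R a u) x).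

Definition RB_rhd (a b : Omega) (x : L) (u : V) : L :=
  mu x (R b u) - R (a * b)%g (mu_l x u) - R (a * b)%g (Phi x (R b u)).

Fact RB_star_bilinear a b : bilinear_for *:%R *:%R (RB_star a b).
Proof.
split=> [v k u1 u2 | u k v1 v2]; rewrite /RB_star /=.
  by rewrite linearP !linearPl !scalerDr [RHS]addrACA [X in _ = X + _]addrACA.
by rewrite !linearPr linearP !linearPr !scalerDr [RHS]addrACA [X in _ = X + _]addrACA.
Qed.

Fact RB_lhd_bilinear a b : bilinear_for *:%R *:%R (RB_lhd a b).
Proof.
split=> [x k u1 u2 | u k x1 x2]; rewrite /RB_lhd /=.
  by rewrite linearP !linearPl !linearP !scalerDr [RHS]addrACA [X in _ = X + _]addrACA.
by rewrite !linearPr !linearP !scalerDr [RHS]addrACA [X in _ = X + _]addrACA.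
Qed.

Fact RB_rhd_bilinear a b : bilinear_for *:%R *:%R (RB_rhd a b).
Proof.
split=> [u k x1 x2 | x k u1 u2]; rewrite /RB_rhd /=.
  by rewrite !linearPl !linearP !scalerDr [RHS]addrACA [X in _ = X + _]addrACA.
rewrite linearP !linearPr !linearP !scalerDr.
by rewrite [RHS]addrACA [X in _ = X + _]addrACA.
Qed.

HB.instance Definition _ a b :=
  bilinear_isBilinear.Build K V V V *:%R *:%R (RB_star a b)
    (RB_star_bilinear a b).
HB.instance Definition _ a b :=
  bilinear_isBilinear.Build K V L L *:%R *:%R (RB_lhd a b)
    (RB_lhd_bilinear a b).
HB.instance Definition _ a b :=
  bilinear_isBilinear.Build K L V L *:%R *:%R (RB_rhd a b)
    (RB_rhd_bilinear a b).

End TwistedRotaBaxterFamily.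

(* Main.v *)
(** On [L * V], the product [(x, u) (y, v) = (x y, x v + u y + Phi (x, y))] is
    Hom-associative, the second component being the cocycle identity. The
    graphs [gr_a u = (R_a u, u)] satisfy [gr_a u gr_b v = gr_(ab) (u *_(a,b) v)],
    and [pi_a (x, u) = x - R_a u] vanishes on [gr_a]; hence
    [pi_(ab) (gr_a u e) = u <|_(a,b) pi_b e] and
    [pi_(ab) (e gr_b u) = pi_a e |>_(a,b) u]. Every axiom is then the image of
    Hom-associativity in [L * V] under the second projection or under some
    [pi_a]. *)
Require Import Defs.
From mathcomp Require Import all_boot all_order all_algebra.
Set Implicit Arguments.
Unset Strict Implicit.
Unset Printing Implicit Defensive.
Import GRing.Theory.
Local Open Scope ring_scope.

Section TwistedSemidirectProduct.
Variables (K : fieldType) (L V : lmodType K).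
Variables (mu : {bilinear L -> L -> L}) (p : {linear L -> L}).
Variables (mu_l : {bilinear L -> V -> V}) (mu_r : {bilinear V -> L -> V})
          (q : {linear V -> V}) (Phi : {bilinear L -> L -> V}).

Definition twisted_mul (e f : L * V) : L * V :=
  (mu e.1 f.1, mu_l e.1 f.2 + mu_r e.2 f.1 + Phi e.1 f.1).

Definition twisted_map (e : L * V) : L * V := (p e.1, q e.2).

Hypotheses (assocL : hom_assoc mu p) (bimodV : hom_bimodule mu p mu_l mu_r q)
           (cocyclePhi : hom_cocycle2 mu p mu_l mu_r q Phi).

Lemma twisted_mapM e f :
  twisted_map (twisted_mul e f) = twisted_mul (twisted_map e) (twisted_map f).
Proof.
rewrite /twisted_map /twisted_mul /= !linearD /=.
by rewrite (hom_assocM assocL) (hom_bimodMl bimodV) (hom_bimodMr bimodV)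
  (hom_cocycle2M cocyclePhi).
Qed.

Lemma twisted_mulA e f g :
  twisted_mul (twisted_map e) (twisted_mul f g) =
  twisted_mul (twisted_mul e f) (twisted_map g).
Proof.
case: e f g => [x u] [y v] [z w]; rewrite /twisted_map /twisted_mul /=.
rewrite (hom_assocA assocL); congr pair.
(* The cocycle identity with its negative terms moved across: these are the four [Phi] terms that
   the bimodule axioms leave unmatched. *)
have PhiE : mu_l (p x) (Phi y z) + Phi (p x) (mu y z) =
            mu_r (Phi x y) (p z) + Phi (mu x y) (p z).
  have /eqP := hom_cocycle2D cocyclePhi x y z.
  by rewrite addrAC (addrAC (mu_l _ _)) -addrA -opprD subr_eq0 => /eqP.
rewrite !linearD !linearDl /= (hom_bimodAll bimodV) (hom_bimodAlr bimodV).
rewrite (hom_bimodArr bimodV) -!addrA; do 2 congr (_ + _).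
by rewrite addrCA PhiE.
Qed.

Variables (Omega : monoidType) (R : Omega -> {linear V -> L}).

Definition RB_graph (a : Omega) (u : V) : L * V := (R a u, u).

Definition RB_proj (a : Omega) (e : L * V) : L := e.1 - R a e.2.

(** Lifts [x] to [L * V] under every index at once, so each axiom can choose the index that its
    actions expect. *)
Lemma RB_proj_inl a x : RB_proj a (x, 0) = x.
Proof. by rewrite /RB_proj linear0 subr0. Qed.

Hypothesis RB_R : twisted_RB_family mu p mu_l mu_r q Phi R.

Lemma twisted_map_graph a u : twisted_map (RB_graph a u) = RB_graph a (q u).
Proof. by rewrite /RB_graph (twisted_RB_familyC RB_R). Qed.

Lemma RB_proj_map a e : RB_proj a (twisted_map e) = p (RB_proj a e).
Proof. by rewrite /RB_proj linearB /= (twisted_RB_familyC RB_R). Qed.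

(** Second components agree by definition of [RB_star]; agreement of the first ones is the twisted
    Rota-Baxter relation itself. *)
Lemma twisted_mul_graph a b u v :
  twisted_mul (RB_graph a u) (RB_graph b v) =
  RB_graph (a * b)%g (RB_star mu_l mu_r Phi R a b u v).
Proof. by rewrite /twisted_mul /= (twisted_RB_familyM RB_R). Qed.

(** For [e = (x, w)], the twisted Rota-Baxter relation expands [mu (R a u) (R b w)] into three terms
    under [R (a * b)]: the [mu_l] term is the one on the left side, and the other two cancel the
    [R b w] parts of [mu_r] and [Phi]. *)
Lemma RB_proj_mull a b u e :
  RB_proj (a * b)%g (twisted_mul (RB_graph a u) e) =
  RB_lhd mu mu_r Phi R a b u (RB_proj b e).
Proof.
case: e => x w; rewrite /RB_proj /RB_lhd /= linearBr.
rewrite (twisted_RB_familyM RB_R) -!addrA -!opprD -!linearD !linearBr.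
congr (_ - R _ _).
by rewrite -[RHS]addrA [X in _ = _ + X]addrACA !subrKC.
Qed.

Lemma RB_proj_mulr a b u e :
  RB_proj (a * b)%g (twisted_mul e (RB_graph b u)) =
  RB_rhd mu mu_l Phi R a b (RB_proj a e) u.
Proof.
case: e => x w; rewrite /RB_proj /RB_rhd /= linearBl.
rewrite (twisted_RB_familyM RB_R) -!addrA -!opprD -!linearD !linearBl.
congr (_ - R _ _); rewrite addrCA [X in _ = X + _]addrCA -[RHS]addrA.
by rewrite [X in _ = _ + X]addrACA !subrKC.
Qed.

End TwistedSemidirectProduct.

Theorem theorem4p6 (Omega : monoidType) (K : fieldType)
    (charK : [pchar K] =i pred0) (L V : lmodType K)
    (mu : {bilinear L -> L -> L}) (p : {linear L -> L})
    (mu_l : {bilinear L -> V -> V}) (mu_r : {bilinear V -> L -> V})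
    (q : {linear V -> V}) (Phi : {bilinear L -> L -> V})
    (R : Omega -> {linear V -> L})
    (assocL : hom_assoc mu p)
    (bimodV : hom_bimodule mu p mu_l mu_r q)
    (cocyclePhi : hom_cocycle2 mu p mu_l mu_r q Phi)
    (RB_R : twisted_RB_family mu p mu_l mu_r q Phi R) :
  hom_omega_assoc (RB_star mu_l mu_r Phi R) q /\
  hom_omega_bimodule (RB_star mu_l mu_r Phi R) q
    (RB_lhd mu mu_r Phi R) (RB_rhd mu mu_l Phi R) p.
Proof.
have mapM := twisted_mapM assocL bimodV cocyclePhi.
have mulA := twisted_mulA assocL bimodV cocyclePhi.
have map_graph := twisted_map_graph RB_R.
have proj_map := RB_proj_map RB_R.
have mul_graph := twisted_mul_graph RB_R.
have proj_mull := RB_proj_mull RB_R.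
have proj_mulr := RB_proj_mulr RB_R.
have proj_inl := RB_proj_inl R.
split; split=> /=.
- move=> u v a b.
  have := mapM (RB_graph R a u) (RB_graph R b v).
  by rewrite mul_graph !map_graph mul_graph => -[].
- move=> u v w a b c.
  have := mulA (RB_graph R a u) (RB_graph R b v)
    (RB_graph R c w).
  (* Only second components are compared, so the graph indices [a * (b * c)] and [(a * b) * c] drop
     out. *)
  by rewrite !map_graph !mul_graph => -[].
- move=> u x a b; rewrite -[x](proj_inl b) -proj_mull -!proj_map -proj_mull.
  by rewrite mapM map_graph.
- move=> x u a b; rewrite -[x](proj_inl a) -proj_mulr -!proj_map -proj_mulr.
  by rewrite mapM map_graph.
- move=> x u v a b c; rewrite -[x](proj_inl a) -proj_map -!proj_mulr.
  (* Both sides are now projections of triple products in [L * V], with indices that agree by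
     associativity in [Omega]. *)
  by rewrite -mul_graph -map_graph mulA mulgA.
(* The middle factor is lifted at [b], the index from which both inner actions start. *)
- move=> u x v a b c; rewrite -[x](proj_inl b) -proj_mulr -!proj_mull -proj_mulr.
  by rewrite -!map_graph mulA mulgA.
- move=> u v x a b c; rewrite -[x](proj_inl c) -proj_map -!proj_mull.
  by rewrite -mul_graph -map_graph mulA mulgA.
Qed.
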